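(* Let $k\ge1$, let $\Omega\subset\mathbb Z^k$ be finite, with $\mathbf 0\in\Omega$ and $|\Omega|=m$. Let $\Gamma\le\mathbb Z^k$ be a subgroup containing $\mathbf 1=(1,\dots,1)$, and suppose that $M\Omega\subset\Gamma$ for some integer $M\ge1$. Let $B$ and $K$ be disjoint finite sets of integers, where $K$ contains exactly $m$ elements in each residue class modulo $M$. Write $\pi:\mathbb Z^k\to\mathbb Z^k/\langle\mathbf 1\rangle$ for the quotient map. Given a family $\mathscr F$ of maps $\psi:B\to\Omega$, define its set of input classes by $$S_{\mathrm{in}}=\left\{\pi\Bigl(\sum_{a\in B}a\psi(a)\Bigr):\psi\in\mathscr F\right\}.$$ Every $\psi\in\mathscr F$ has an extension $\widetilde\psi:B\cup K\to\Omega$ for which $\sum_{a\in B\cup K}a\widetilde\psi(a)\in\Gamma$. The extensions can be chosen (one for each $\psi\in\mathscr F$) so that their set of output classes $$S_{\mathrm{out}}=\left\{\pi\Bigl(\sum_{a\in B\cup K}a\widetilde\psi(a)\Bigr):\psi\in\mathscr F\right\}$$ satisfies $$|S_{\mathrm{out}}|\ge\frac{|S_{\mathrm{in}}|}{(mM)^m}.$$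
   Context: $\langle\mathbf 1\rangle$ in $\mathbb Z^k/\langle\mathbf 1\rangle$ denotes $\mathbb Z\mathbf 1$; for integral vectors, equality modulo $\mathbb Z\mathbf 1$ is the same as equality modulo $\mathbb Q\mathbf 1$. $M\Omega=\{M\omega:\omega\in\Omega\}$. *)

(* Defs.v *)
From HB Require Import structures.
From mathcomp Require Import all_boot all_order all_algebra.
From mathcomp Require Import finmap boolp.

Set Implicit Arguments.
Unset Strict Implicit.
Unset Printing Implicit Defensive.

Import GRing.Theory.
Local Open Scope ring_scope.
Local Open Scope fset_scope.

Definition ones (k : nat) : 'rV[int]_k := const_mx 1.

Definition Zones (k : nat) : {pred 'rV[int]_k} :=
  fun v => `[< exists c : int, v = c *: ones k >].

Lemma Zones_zmod_closed (k : nat) : zmod_closed (@Zones k).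
Proof.
split=> [|u v]; first by apply/asboolP; exists 0; rewrite scale0r.
move=> /asboolP[c ->] /asboolP[d ->].
by apply/asboolP; exists (c - d); rewrite scalerBl.
Qed.

HB.instance Definition _ (k : nat) :=
  GRing.isZmodClosed.Build 'rV[int]_k (@Zones k) (@Zones_zmod_closed k).

(* MathComp quotients a zmodType by a Boolean zmodClosed predicate, hence the
   classical reflection [asbool] in [Zones]; [pi_onesP] below confirms that the
   quotient identifies exactly the vectors differing by an integer multiple of
   the all-ones vector. *)
Definition quot_ones (k : nat) : choiceType := Quotient.quot (@Zones k).

Definition pi_ones (k : nat) (v : 'rV[int]_k) : quot_ones k :=
  (\pi_(Quotient.quot (@Zones k)))%qT v.

Lemma pi_onesP (k : nat) (u v : 'rV[int]_k) :
  pi_ones u = pi_ones v <-> exists c : int, u - v = c *: ones k.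
Proof.
have E : (u - v \in @Zones k) = (pi_ones u == pi_ones v).
  exact: Quotient.idealrBE.
split=> [/eqP H|H].
  by move: H; rewrite -E => /asboolP.
by apply/eqP; rewrite -E; apply/asboolP.
Qed.

Definition wsum (k : nat) (Omega : {fset 'rV[int]_k}) (A : {fset int})
    (psi : {ffun A -> Omega}) : 'rV[int]_k :=
  \sum_(a : A) val a *: val (psi a).

Definition extends (k : nat) (Omega : {fset 'rV[int]_k}) (B K : {fset int})
    (psi : {ffun B -> Omega}) (psit : {ffun (B `|` K) -> Omega}) : Prop :=
  forall a : B, psit (fincl (fsubsetUl B K) a) = psi a.

Definition S_in (k : nat) (Omega : {fset 'rV[int]_k}) (B : {fset int})
    (F : {set {ffun B -> Omega}}) : {fset quot_ones k} :=
  [fset pi_ones (wsum psi) | psi in F].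

Definition S_out (k : nat) (Omega : {fset 'rV[int]_k}) (B K : {fset int})
    (F : {set {ffun B -> Omega}})
    (ext : {ffun B -> Omega} -> {ffun (B `|` K) -> Omega}) :
    {fset quot_ones k} :=
  [fset pi_ones (wsum (ext psi)) | psi in F].

(* Main.v *)
Require Import Defs.
From mathcomp Require Import all_boot all_order all_algebra.
From mathcomp Require Import finmap.
From mathcomp Require boolp.
Import GRing.Theory Num.Theory.
Local Open Scope ring_scope.
Local Open Scope fset_scope.

(** Grouping the terms of a weighted sum by value writes it as the sum of
    [x_w w] over [w] in [Omega], where [x_w] is the total weight of the indices
    sent to [w].  Since [M w] lies in [Gamma], such a sum lies in [Gamma] as
    soon as [M] divides every [x_w].  To arrange this, choose for each [w] an
    element [e_w] of [K] congruent to [- x_w] modulo [M], with distinct [w]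
    receiving distinct elements; there is room because a residue class meets
    [K] in as many elements as [Omega] has ([distinct_representatives]).
    Extending by [e_w |-> w], and by [0] on the rest of [K], turns the
    coefficient [x_w] into [x_w + e_w] ([wsum_extend_by]).

    The vector added is the sum of the [e_w w].  If the choice of [e] is made
    once and for all for each residue vector [(x_w mod M)_w], the added vector
    takes at most [M ^ m] values, and the output class together with the residue
    vector determines the input class.  Hence the number of input classes is at
    most [M ^ m] times the number of output classes ([card_imfset_refine]),
    which is stronger than the bound with [(m M) ^ m]. *)

(** The representative of [r i] is the [i]-th element of its class in [K]: two
    indices with equal representatives share a class, hence have the same
    position in the same list. *)
Lemma distinct_representatives {I : finType} {M : nat} {K : {fset int}}
    (hK : forall r : int,
       (#|I| <= #|` [fset a in K | (a == r %[mod M%:Z])%Z]|)%N)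
    (r : I -> int) :
  exists e : I -> int,
    [/\ injective e, forall i, e i \in K
      & forall i, (e i == r i %[mod M%:Z])%Z].
Proof.
pose C x := [fset a in K | (a == x %[mod M%:Z])%Z].
pose e i := nth 0 (C (r i)) (enum_rank i).
have rank_lt x (i : I) : (enum_rank i < size (C x))%N.
  exact: leq_trans (ltn_ord _) (hK x).
have eC i : e i \in C (r i) by apply: mem_nth; apply: rank_lt.
have eP i : (e i \in K) /\ (e i == r i %[mod M%:Z])%Z.
  by apply/andP; move: (eC i); rewrite !inE.
exists e; split=> [i j eij|i|i]; [|by case: (eP i)|by case: (eP i)].
have Cij : C (r i) = C (r j).
  have [_ /eqP ei] := eP i; have [_ /eqP ej] := eP j.
  by apply/fsetP=> a; rewrite !inE -ei eij ej.
apply: enum_rank_inj; apply: val_inj; apply/eqP.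
by rewrite -(nth_uniq 0 (rank_lt (r i) i) (rank_lt _ j) (fset_uniq _)) {2}Cij;
   apply/eqP.
Qed.

Lemma wsum_restrict {k : nat} {Omega : {fset 'rV[int]_k}} {A : {fset int}}
    (psi : {ffun A -> Omega}) (g : int -> Omega) :
  (forall a : A, psi a = g (val a)) ->
  wsum psi = \sum_(a <- A) a *: val (g a).
Proof.
by move=> psig; rewrite big_seq_fsetE; apply: eq_bigr => a _; rewrite psig.
Qed.

Definition weight {k : nat} {Omega : {fset 'rV[int]_k}} {A : {fset int}}
    (psi : {ffun A -> Omega}) (w : Omega) : int :=
  \sum_(a : A | psi a == w) val a.

Lemma wsum_weight {k : nat} {Omega : {fset 'rV[int]_k}} {A : {fset int}}
    (psi : {ffun A -> Omega}) :
  wsum psi = \sum_w weight psi w *: val w.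
Proof.
rewrite /wsum (partition_big psi predT) //=; apply: eq_bigr => w _.
by rewrite scaler_suml; apply: eq_bigr => a /eqP ->.
Qed.

Lemma sum_mulz_mem {k : nat} {Omega : {fset 'rV[int]_k}}
    (Gamma : zmodClosed 'rV[int]_k) (M : nat)
    (hMOmega : forall omega, omega \in Omega -> M%:Z *: omega \in Gamma)
    (x : Omega -> int) (hx : forall w, (M%:Z %| x w)%Z) :
  \sum_w x w *: val w \in Gamma.
Proof.
apply: rpred_sum => w _; have /dvdzP[q ->] := hx w.
by rewrite -scalerA -(intz q) scaler_int rpredMz ?hMOmega ?fsvalP.
Qed.

(** Totality on the integers lets the sums over [B], [K] and their union share
    one summand, instead of transporting indices between three subtypes. *)
Definition extend_by_fun {k : nat} {Omega : {fset 'rV[int]_k}} {B : {fset int}}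
    (o : Omega) (e : Omega -> int) (psi : {ffun B -> Omega}) (a : int) : Omega :=
  if insub a is Some b then psi b else odflt o [pick w | e w == a].

Definition extend_by {k : nat} {Omega : {fset 'rV[int]_k}} {B K : {fset int}}
    (o : Omega) (e : Omega -> int) (psi : {ffun B -> Omega}) :
    {ffun (B `|` K) -> Omega} :=
  [ffun a => extend_by_fun o e psi (val a)].

Lemma extend_by_fun_val {k : nat} {Omega : {fset 'rV[int]_k}} {B : {fset int}}
    (o : Omega) (e : Omega -> int) (psi : {ffun B -> Omega}) (b : B) :
  extend_by_fun o e psi (val b) = psi b.
Proof. by rewrite /extend_by_fun valK. Qed.

Lemma extends_extend_by {k : nat} {Omega : {fset 'rV[int]_k}}
    {B K : {fset int}}
    (o : Omega) (e : Omega -> int) (psi : {ffun B -> Omega}) :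
  extends psi (extend_by (K := K) o e psi).
Proof. by move=> b; rewrite ffunE /= extend_by_fun_val. Qed.

(** Injectivity of [e] is what keeps the added terms apart: an element of [K]
    is the image of at most one [w], so each [w] contributes exactly once. *)
Lemma wsum_extend_by {k : nat} {Omega : {fset 'rV[int]_k}} {B K : {fset int}}
    (hBK : [disjoint B & K]) {o : Omega} (ho : val o = 0)
    {e : Omega -> int} (einj : injective e) (eK : forall w, e w \in K)
    (psi : {ffun B -> Omega}) :
  wsum (extend_by (K := K) o e psi)
    = (wsum psi + \sum_w e w *: val w)%R.
Proof.
pose g := extend_by_fun o e psi.
have -> : wsum (extend_by (K := K) o e psi)
            = \sum_(a <- B `|` K) a *: val (g a).
  by apply: wsum_restrict => a; rewrite ffunE.
have -> : wsum psi = \sum_(a <- B) a *: val (g a).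
  by apply: wsum_restrict => a; rewrite /g extend_by_fun_val.
rewrite (perm_big (enum_fset B ++ enum_fset K)) /=; last first.
  apply: uniq_perm => [||a]; rewrite ?fset_uniq //.
    rewrite cat_uniq !fset_uniq andbT /=; apply/hasPn => a aK.
    by apply: contraL aK; apply/fdisjointP.
  by rewrite mem_cat in_fsetU.
rewrite big_cat /=; congr (_ + _)%R.
have gK a : a \in K -> a *: val (g a) = \sum_(w | e w == a) e w *: val w.
  move=> aK; have aB : a \notin B.
    by apply: contraL aK; apply/fdisjointP.
  rewrite /g /extend_by_fun insubF ?(negbTE aB) //.
  case: pickP => [w /eqP <-|ea] /=; last by rewrite big_pred0 // ho scaler0.
  by rewrite (big_pred1 w) // => w'; rewrite (inj_eq einj).
rewrite big_seq (eq_bigr _ gK) -big_seq (exchange_big_dep predT) //=.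
apply: eq_bigr => w _; under eq_bigl do rewrite eq_sym.
by rewrite -big_filter filter_pred1_uniq ?fset_uniq // big_seq1.
Qed.

(** The pair [(g x, h x)] determines [f x], so each value of [f] is recovered
    from some pair in the product. *)
Lemma card_imfset_refine {T U : finType} {X Y : choiceType}
    (f : T -> X) (g : T -> Y) (h : T -> U) (F : {set T}) :
  {in F &, forall x y, g x = g y -> h x = h y -> f x = f y} ->
  (#|` [fset f x | x in F]| <= #|` [fset g x | x in F]| * #|U|)%N.
Proof.
move=> fgh; set G := [fset g x | x in F].
pose pairs := [seq (y, u) | y <- enum_fset G, u <- enum U].
pose phi (p : Y * U) := omap f [pick x in F | (g x == p.1) && (h x == p.2)].
have -> : (#|` G| * #|U|)%N = size pairs by rewrite size_allpairs -cardE.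
apply: (@leq_trans (size (pmap phi pairs))); last first.
  by rewrite size_pmap count_size.
apply: uniq_leq_size (fset_uniq _) _ => _ /imfsetP[x /= xF ->].
rewrite mem_pmap; apply/mapP; exists (g x, h x).
  apply/allpairsP; exists (g x, h x); split; rewrite ?mem_enum //=.
  exact: in_imfset.
rewrite /phi; case: pickP => [z /and3P[zF /eqP gz /eqP hz]|/(_ x)] /=.
  by congr Some; apply: fgh.
by rewrite xF !eqxx.
Qed.

Lemma exists_ord_eqmodz {M : nat} (hM : (1 <= M)%N) (x : int) :
  exists c : 'I_M, ((c : nat)%:Z == x %[mod M%:Z])%Z.
Proof.
have M0 : M%:Z != 0 by rewrite eqz_nat -lt0n.
have xM : (`|(x %% M%:Z)%Z| < M)%N.
  by rewrite -ltz_nat gez0_abs ?modz_ge0 // ltz_pmod.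
by exists (Ordinal xM); rewrite /= gez0_abs ?modz_ge0 // modz_mod.
Qed.

Theorem lemmaA2 (k : nat) (hk : (1 <= k)%N)
    (Omega : {fset 'rV[int]_k}) (m : nat)
    (hOmega0 : 0 \in Omega) (hm : #|` Omega| = m)
    (Gamma : zmodClosed 'rV[int]_k) (hGamma1 : ones k \in Gamma)
    (M : nat) (hM : (1 <= M)%N)
    (hMOmega : forall omega, omega \in Omega -> M%:Z *: omega \in Gamma)
    (B K : {fset int}) (hBK : [disjoint B & K])
    (hK : forall r : int, #|` [fset a in K | (a == r %[mod M%:Z])%Z]| = m)
    (F : {set {ffun B -> Omega}}) :
  (forall psi, psi \in F ->
     exists psit : {ffun (B `|` K) -> Omega},
       extends psi psit /\ wsum psit \in Gamma) /\
  (exists ext : {ffun B -> Omega} -> {ffun (B `|` K) -> Omega},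
     (forall psi, psi \in F ->
        extends psi (ext psi) /\ wsum (ext psi) \in Gamma) /\
     #|` S_in F|%:R / ((m * M) ^ m)%N%:R <= #|` S_out F ext|%:R :> rat).
Proof.
have cardOmega : #|{: Omega}| = m by rewrite -hm cardfE.
have m_gt0 : (0 < m)%N by rewrite -hm cardfs_gt0; apply/fset0Pn; exists 0.
have /boolp.choice[res resP] := exists_ord_eqmodz hM.
have hKI r :
    (#|{: Omega}| <= #|` [fset a in K | (a == r %[mod M%:Z])%Z]|)%N.
  by rewrite hK cardOmega.
(* The representatives depend on the residue vector alone, not on psi. *)
have /boolp.choice[rep repP] := fun c : {ffun Omega -> 'I_M} =>
  distinct_representatives hKI (fun w => - (c w : nat)%:Z).
pose resvec (psi : {ffun B -> Omega}) := [ffun w => res (weight psi w)].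
pose added c := \sum_w rep c w *: val (w : Omega).
pose ext psi : {ffun (B `|` K) -> Omega} :=
  extend_by [` hOmega0] (rep (resvec psi)) psi.
have wsum_ext psi : wsum (ext psi) = (wsum psi + added (resvec psi))%R.
  by have [einj eK _] := repP (resvec psi); apply: wsum_extend_by.
have extP psi : extends psi (ext psi) /\ wsum (ext psi) \in Gamma.
  split; first exact: extends_extend_by.
  rewrite wsum_ext wsum_weight -big_split /=.
  under eq_bigr do rewrite -scalerDl.
  apply: (sum_mulz_mem _ _ hMOmega) => w.
  have [_ _ /(_ w)] := repP (resvec psi).
  have := resP (weight psi w).
  rewrite !eqz_mod_dvd ffunE opprK => d1 d2.
  set x := weight psi w in d1 d2 *; set c := (res x : nat)%:Z in d1 d2.
  have -> : (x + rep (resvec psi) w = rep (resvec psi) w + c - (c - x))%R.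
    by rewrite opprB addrCA addrK.
  exact: rpredB.
split=> [psi _|]; first by exists (ext psi).
exists ext; split=> [psi _ //|].
have le_card : (#|` S_in F| <= #|` S_out F ext| * M ^ m)%N.
  have -> : (M ^ m)%N = #|{ffun Omega -> 'I_M}|.
    by rewrite card_ffun card_ord cardOmega.
  apply: (card_imfset_refine _ _ resvec) => psi psi' _ _.
  move=> /pi_onesP[c out_eq] res_eq; apply/pi_onesP; exists c.
  by rewrite -out_eq !wsum_ext res_eq opprD addrACA subrr addr0.
rewrite ler_pdivrMr ?ltr0n ?expn_gt0 ?muln_gt0 ?m_gt0 ?hM //.
rewrite -natrM ler_nat (leq_trans le_card) // leq_mul2l leq_exp2r //.
by rewrite leq_pmull ?orbT.
Qed.
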